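(* Let $s\geq 1$ be an integer. Then $$\mathrm{Aut}(\Gamma(\mathbb{Z}_{2^{s}}[i,j,k]))\cong \mathrm{Reg}(\Gamma(\mathbb{Z}_{2^{s}}[i,j,k]))\rtimes \mathrm{Aut}(\Gamma_{E}(\mathbb{Z}_{2^{s}}[i,j,k])).$$
   Context: $\mathbb{Z}_{2^s}[i,j,k]=\{a+bi+cj+dk\mid a,b,c,d\in\mathbb{Z}_{2^s}\}$ is the ring of Lipschitz quaternions modulo $2^s$, with the usual quaternion multiplication. For a ring $R$, $Z^*(R)$ is the set of non-zero zero divisors. The zero divisor graph $\Gamma(R)$ has vertex set $Z^*(R)$ with an edge $a\to b$ between distinct vertices $a,b$ if and only if $ab=0$. The ring $\mathbb{Z}_{2^s}[i,j,k]$ is reversible ($ab=0$ implies $ba=0$), so $\Gamma=\Gamma(\mathbb{Z}_{2^s}[i,j,k])$ can be regarded as an undirected graph. $\mathrm{Aut}$ denotes the group of graph automorphisms (adjacency-preserving and adjacency-reflecting bijections of the vertex set) under composition. For $a\in V(\Gamma)$, $N_r(a)=\{b\in V(\Gamma)\mid ab=0\}$ and $N_l(a)=\{b\in V(\Gamma)\mid ba=0\}$; $N(a)=N(b)$ means $N_r(a)=N_r(b)$ and $N_l(a)=N_l(b)$, and then $a,b$ are called twin points. A bijection $\varphi$ of $V(\Gamma)$ such that $\varphi(a)=b$ always implies that $a,b$ are twin points is an automorphism of $\Gamma$, called a regular automorphism; $\mathrm{Reg}(\Gamma)$ is the group of all regular automorphisms of $\Gamma$. Put $\bar a=\{b\in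 V(\Gamma)\mid a,b \text{ are twin points}\}$. The compressed graph $\Gamma_E=\Gamma_E(\mathbb{Z}_{2^s}[i,j,k])$ has vertex set $\{\bar a\mid a\in V(\Gamma)\}$, and distinct vertices $\bar a,\bar b$ are adjacent if and only if $a$ and $b$ are adjacent in $\Gamma$. *)

(* Defs.v *)
From HB Require Import structures.
From mathcomp Require Import all_boot all_order all_algebra all_fingroup.
From mathcomp Require Import ring.

Set Implicit Arguments.
Unset Strict Implicit.
Unset Printing Implicit Defensive.

Import GRing.Theory.

Local Open Scope ring_scope.

(* [Lipschitz a b c d] is the quaternion a + b i + c j + d k. *)
Record lipschitz (R : Type) := Lipschitz { qre : R; qi : R; qj : R; qk : R }.

Definition lipschitz_tuple (R : Type) (x : lipschitz R) : R * R * R * R :=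
  (qre x, qi x, qj x, qk x).
Definition tuple_lipschitz (R : Type) (t : R * R * R * R) : lipschitz R :=
  let: (a, b, c, d) := t in Lipschitz a b c d.

Lemma lipschitz_tupleK (R : Type) :
  cancel (@lipschitz_tuple R) (@tuple_lipschitz R).
Proof. by case. Qed.

HB.instance Definition _ (R : eqType) :=
  Equality.copy (lipschitz R) (can_type (@lipschitz_tupleK R)).
HB.instance Definition _ (R : choiceType) :=
  Choice.copy (lipschitz R) (can_type (@lipschitz_tupleK R)).
HB.instance Definition _ (R : countType) :=
  Countable.copy (lipschitz R) (can_type (@lipschitz_tupleK R)).
HB.instance Definition _ (R : finType) :=
  Finite.copy (lipschitz R) (can_type (@lipschitz_tupleK R)).

Section Zmodule.
Variable R : zmodType.
Implicit Types x y : lipschitz R.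

Definition lip_zero : lipschitz R := Lipschitz 0 0 0 0.
Definition lip_opp x := Lipschitz (- qre x) (- qi x) (- qj x) (- qk x).
Definition lip_add x y :=
  Lipschitz (qre x + qre y) (qi x + qi y) (qj x + qj y) (qk x + qk y).

Fact lip_addA : associative lip_add.
Proof. by move=> x y z; rewrite /lip_add /= !addrA. Qed.
Fact lip_addC : commutative lip_add.
Proof.
move=> x y; rewrite /lip_add.
by congr Lipschitz; rewrite addrC.
Qed.
Fact lip_add0 : left_id lip_zero lip_add.
Proof. by case=> a b c d; rewrite /lip_add /= !add0r. Qed.
Fact lip_addN : left_inverse lip_zero lip_opp lip_add.
Proof. by move=> x; rewrite /lip_add /= !addNr. Qed.

HB.instance Definition _ := GRing.isZmodule.Build (lipschitz R)
  lip_addA lip_addC lip_add0 lip_addN.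
End Zmodule.

Section Ring.
Variable R : comNzRingType.
Implicit Types x y : lipschitz R.

Definition lip_one : lipschitz R := Lipschitz 1 0 0 0.
Definition lip_mul x y :=
  let: Lipschitz a b c d := x in let: Lipschitz a' b' c' d' := y in
  Lipschitz (a * a' - b * b' - c * c' - d * d')
            (a * b' + b * a' + c * d' - d * c')
            (a * c' - b * d' + c * a' + d * b')
            (a * d' + b * c' - c * b' + d * a').

Fact lip_mulA : associative lip_mul.
Proof.
by case=> [a b c d] [a' b' c' d'] [e f g h]; congr Lipschitz; ring.
Qed.
Fact lip_mul1 : left_id lip_one lip_mul.
Proof. by case=> a b c d; congr Lipschitz; ring. Qed.
Fact lip_mulr1 : right_id lip_one lip_mul.
Proof. by case=> a b c d; congr Lipschitz; ring. Qed.
Fact lip_mulDl : left_distributive lip_mul (@lip_add R).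
Proof.
by case=> [a b c d] [a' b' c' d'] [e f g h]; congr Lipschitz; rewrite /=; ring.
Qed.
Fact lip_mulDr : right_distributive lip_mul (@lip_add R).
Proof.
by case=> [a b c d] [a' b' c' d'] [e f g h]; congr Lipschitz; rewrite /=; ring.
Qed.
Fact lip_oner_neq0 : lip_one != lip_zero R.
Proof. by apply/eqP=> -[] /eqP; rewrite oner_eq0. Qed.

HB.instance Definition _ := GRing.Zmodule_isNzRing.Build (lipschitz R)
  lip_mulA lip_mul1 lip_mulr1 lip_mulDl lip_mulDr lip_oner_neq0.
End Ring.

HB.instance Definition _ (R : finComNzRingType) :=
  Finite.on (lipschitz R).

Section Graph.
Variables (T : finType) (e : rel T).

Definition graph_aut : {set {perm T}} :=
  [set p : {perm T} | [forall x, forall y, e (p x) (p y) == e x y]].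

Fact graph_aut_group_set : group_set graph_aut.
Proof.
apply/group_setP; split.
  by rewrite inE; apply/forallP=> x; apply/forallP=> y; rewrite !perm1.
move=> p q; rewrite !inE => /'forall_forallP pP /'forall_forallP qP.
apply/'forall_forallP=> x y.
by rewrite !permM (eqP (qP _ _)).
Qed.
Canonical graph_aut_group := Group graph_aut_group_set.
End Graph.

Section ZeroDivisorGraph.
Variable R : finNzRingType.

Definition nz_zero_divisor : {pred R} := fun a =>
  (a != 0) && [exists b : R, (b != 0) && ((a * b == 0) || (b * a == 0))].

Definition zdg_vertex : predArgType := {a : R | a \in nz_zero_divisor}.
HB.instance Definition _ := SubFinite.on zdg_vertex.
Implicit Types a b c : zdg_vertex.

Definition zdg_edge : rel zdg_vertex :=
  fun a b => (a != b) && (val a * val b == 0).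

(* Unlike graph neighbourhoods, these contain [a] itself when a ^ 2 = 0. *)
Definition nbhr a : {set zdg_vertex} := [set b | val a * val b == 0].
Definition nbhl a : {set zdg_vertex} := [set b | val b * val a == 0].

Definition twin : rel zdg_vertex :=
  fun a b => (nbhr a == nbhr b) && (nbhl a == nbhl b).

Definition regular_aut : {set {perm zdg_vertex}} :=
  [set p : {perm zdg_vertex} | [forall a, twin a (p a)]].

Fact regular_aut_group_set : group_set regular_aut.
Proof.
apply/group_setP; split.
  by rewrite inE; apply/forallP=> a; rewrite /twin /= perm1 !eqxx.
move=> p q; rewrite !inE => /forallP pP /forallP qP; apply/forallP=> a.
have /andP[/eqP r1 /eqP l1] := pP a.
have /andP[/eqP r2 /eqP l2] := qP (p a).
by rewrite /twin /= permM r1 l1 r2 l2 !eqxx.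
Qed.
Canonical regular_aut_group := Group regular_aut_group_set.

Lemma regular_aut_sub : regular_aut \subset graph_aut zdg_edge.
Proof.
apply/subsetP=> p; rewrite !inE => /forallP pP.
apply/'forall_forallP=> a b; rewrite /zdg_edge /= (inj_eq perm_inj).
have /andP[/eqP/setP/(_ (p b)) ra _] := pP a.
have /andP[_ /eqP/setP/(_ a) lb] := pP b.
by rewrite !inE in ra lb; rewrite lb ra.
Qed.

Definition twin_class a : {set zdg_vertex} := [set b | twin a b].

Definition cg_vertex : predArgType :=
  {A : {set zdg_vertex} | A \in [set twin_class a | a : zdg_vertex]}.
HB.instance Definition _ := SubFinite.on cg_vertex.

(* Adjacency does not depend on the representatives: see [cg_edgeE]. *)
Definition cg_edge : rel cg_vertex :=
  fun A B => (A != B) &&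
    [exists a in val A, exists b in val B, zdg_edge a b].

Fact twin_class_vertex a :
  twin_class a \in [set twin_class b | b : zdg_vertex].
Proof. exact: imset_f. Qed.

Definition cg_class a : cg_vertex := Sub (twin_class a) (twin_class_vertex a).

Lemma cg_edgeE a b :
  cg_edge (cg_class a) (cg_class b) =
  (cg_class a != cg_class b) && zdg_edge a b.
Proof.
rewrite /cg_edge /=; case: (eqVneq (cg_class a) (cg_class b)) => //= neq.
have neq_ab : a != b by apply: contraNneq neq => ->.
apply/idP/idP => [/exists_inP[a' aa' /exists_inP[b' bb']] | ab]; last first.
  apply/exists_inP; exists a; first by rewrite inE /twin /= !eqxx.
  by apply/exists_inP; exists b; first by rewrite inE /twin /= !eqxx.
move: aa' bb'; rewrite !inE.
move=> /andP[/eqP/setP/(_ b') ra _] /andP[_ /eqP/setP/(_ a) lb].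
rewrite /zdg_edge /= neq_ab /=; case/andP=> _.
by rewrite !inE in ra lb; rewrite lb ra.
Qed.

End ZeroDivisorGraph.

(* Main.v *)
Require Import Defs.
From mathcomp Require Import all_boot all_order all_algebra all_fingroup.
From mathcomp Require Import ring zify.

(* For a quaternion x with integer coefficients put v x := v_2 (norm x).  On Lipschitz
   quaternions v is an ultrametric, additive on products, and v x > 2 s forces
   2 ^ s to divide x.  So every vertex a of Gamma gets a level (the valuation of
   any integer lift) 1 <= lev a <= 2 s, and a b = 0 is decided by lev a + lev b except when
   this sum equals 2 s; at that threshold the product is a nondegenerate pairing
   between the cosets of the two levels.  The twin class of a vertex a of level
   m < 2 s is the coset a + {v > m}, whose size depends only on m; exactly one
   class of level 2 s - m is annihilated by a, and at least two are not.

   Counting annihilators shows that in both Gamma and Gamma_E the degree of a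
   vertex determines its level and whether it squares to zero, although the
   graphs carry no loops.  Hence automorphisms of Gamma permute twin
   classes, and automorphisms of Gamma_E preserve class sizes and loops and lift
   to Gamma through a fixed enumeration of each class.  These lifts form a
   complement of Reg(Gamma). *)

Set Implicit Arguments.
Unset Strict Implicit.
Unset Printing Implicit Defensive.

Import GRing.Theory Num.Theory Order.TTheory.
Local Open Scope ring_scope.

(** * The norm of integer Lipschitz quaternions and its 2-adic valuation *)

Section LipschitzQuaternions.
Implicit Types x y z w : lipschitz int.

Definition qnorm x : int := qre x ^+ 2 + qi x ^+ 2 + qj x ^+ 2 + qk x ^+ 2.

Definition qconj x : lipschitz int := Lipschitz (qre x) (- qi x) (- qj x) (- qk x).

Lemma qnormM x y : qnorm (x * y) = qnorm x * qnorm y.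
Proof. by case: x y => [a b c d] [a' b' c' d']; rewrite /qnorm /=; ring. Qed.

Lemma qnorm_conj x : qnorm (qconj x) = qnorm x.
Proof. by case: x => a b c d; rewrite /qnorm /=; ring. Qed.

Lemma lip_mulrn (R : zmodType) (x : lipschitz R) n :
  x *+ n = Lipschitz (qre x *+ n) (qi x *+ n) (qj x *+ n) (qk x *+ n).
Proof. by elim: n => [|n IHn]; rewrite ?mulr0n // !mulrS IHn. Qed.

Lemma qnormMn x n : qnorm (x *+ n) = n%:Z ^+ 2 * qnorm x.
Proof.
have mulE (a : int) : a *+ n = n%:Z * a by rewrite -mulr_natl natz.
by rewrite lip_mulrn /qnorm /= !mulE; ring.
Qed.

Lemma mul_qconj x : x * qconj x = Lipschitz (qnorm x) 0 0 0.
Proof. by case: x => a b c d; rewrite /qnorm; congr Lipschitz => /=; ring. Qed.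

Lemma mul_qconjl x : qconj x * x = Lipschitz (qnorm x) 0 0 0.
Proof. by case: x => a b c d; rewrite /qnorm; congr Lipschitz => /=; ring. Qed.

Lemma qnormD x y :
  qnorm (x + y) = qnorm x + qnorm y + 2 * qre (x * qconj y).
Proof. by case: x y => [a b c d] [a' b' c' d']; rewrite /qnorm /=; ring. Qed.

(** Encodes [k <= v x] by divisibility, so that [0], of infinite valuation, needs no separate
    case. *)
Definition dv k x := ((2 ^ k)%N%:Z %| qnorm x)%Z.

Lemma dv_leq k l x : (k <= l)%N -> dv l x -> dv k x.
Proof. by move=> kl; apply: dvdz_trans; rewrite dvdzE !absz_nat dvdn_exp2l. Qed.

Lemma dv0 k : dv k 0.
Proof. by rewrite /dv (_ : qnorm 0 = 0) ?dvdz0. Qed.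

Lemma dvM k l x y : dv k x -> dv l y -> dv (k + l) (x * y).
Proof. by rewrite /dv qnormM expnD PoszM; apply: dvdz_mul. Qed.

Lemma dv_conj k x : dv k (qconj x) = dv k x.
Proof. by rewrite /dv qnorm_conj. Qed.

Lemma dv_mulrn k l x : dv l x -> dv (k.*2 + l) (x *+ (2 ^ k)).
Proof.
rewrite /dv qnormMn expnD PoszM => h; apply: dvdz_mul => //.
by rewrite -muln2 expnM PoszM.
Qed.

Lemma sqr_parity (a : int) :
  (exists q u : int, a = 2 * q /\ a ^+ 2 = 4 * u) \/
  (exists t : int, a ^+ 2 = 8 * t + 1).
Proof.
(* The residue modulo 4 determines the square modulo 8. *)
have Da := divz_eq a 4; have := @modz_ge0 a 4 isT; have := @ltz_pmod a 4 isT.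
set q := (a %/ 4)%Z in Da; set r := (a %% 4)%Z in Da *.
move=> r4 r0.
have : r = 0 \/ r = 1 \/ r = 2 \/ r = 3 by lia.
case=> [|[|[|]]] Dr; [left; exists (2 * q), (4 * q ^+ 2)
  | right; exists (2 * q ^+ 2 + q)
  | left; exists (2 * q + 1), ((2 * q + 1) ^+ 2)
  | right; exists (2 * q ^+ 2 + 3 * q + 1)];
  try split; rewrite Da Dr; ring.
Qed.

(** An odd square is 1 modulo 8, an even one 0 modulo 4. If [a] were odd, a sum divisible by 4 would
    force all four terms to be odd, and the sum would then be 4 modulo 8. *)
Lemma sum4_sqr_even (a b c d k : int) :
  a ^+ 2 + b ^+ 2 + c ^+ 2 + d ^+ 2 = k * 8 -> exists q : int, a = 2 * q.
Proof.
have [[q [u [-> _]]]|] := sqr_parity a; first by exists q.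
have sq (e : int) : exists2 E : int, e ^+ 2 = E &
    (exists u : int, E = 4 * u) \/ (exists u : int, E = 8 * u + 1).
  exists (e ^+ 2) => //.
  by have [[q [u [_ ->]]]|[u ->]] := sqr_parity e; [left | right]; exists u.
move: (a ^+ 2) (sq b) (sq c) (sq d) => A [B -> hB] [C -> hC] [D -> hD].
clear -hB hC hD => -[t ->] h; exfalso; move: hB hC hD h.
by do 3![case=> -[? ->]]; lia.
Qed.

Lemma dv3_even x : dv 3 x -> exists y, x = y *+ 2.
Proof.
case: x => a b c d; rewrite /dv /qnorm /= => /dvdzP[k h].
have [a' Da] := sum4_sqr_even h.
have [b' Db] : exists q : int, b = 2 * q.
  by apply: (@sum4_sqr_even b a c d k); rewrite -[RHS]h; ring.
have [c' Dc] : exists q : int, c = 2 * q.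
  by apply: (@sum4_sqr_even c a b d k); rewrite -[RHS]h; ring.
have [d' Dd] : exists q : int, d = 2 * q.
  by apply: (@sum4_sqr_even d a b c k); rewrite -[RHS]h; ring.
exists (Lipschitz a' b' c' d'); rewrite lip_mulrn Da Db Dc Dd.
by congr Lipschitz; rewrite mulr_natl.
Qed.

(** Each halving lowers the exponent by 2, and [2 k + 1] leaves at least the 3 that [dv3_even]
    requires before each of the [k] halvings. *)
Lemma dv_div k x : dv k.*2.+1 x -> exists y, x = y *+ (2 ^ k).
Proof.
elim: k x => [|k IHk] x hx; first by exists x.
have [] := @dv3_even x; first by apply: dv_leq hx; lia.
move=> x' Dx; have [|y Dy] := IHk x'.
  move: hx; rewrite /dv Dx qnormMn doubleS (expnD 2 2 k.*2.+1) PoszM.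
  by rewrite dvdz_mul2l.
by exists y; rewrite Dx Dy -mulrnA expnSr.
Qed.

(* [2 qre w] is divisible by [2 ^ k] as soon as [4 ^ k] divides [qnorm w]; apply
   this to the cross term [w = x * qconj y]. *)
Lemma dvD k x y : dv k x -> dv k y -> dv k (x + y).
Proof.
case: k => [|k] hx hy; first by rewrite /dv dvd1z.
rewrite /dv qnormD; apply: rpredD; first exact: rpredD.
have [|w ->] := @dv_div k (x * qconj y).
  have hy' : dv k.+1 (qconj y) by rewrite dv_conj.
  by apply: dv_leq (dvM hx hy'); lia.
by rewrite lip_mulrn /= expnS PoszM dvdz_mul2l // -mulr_natl natz dvdz_mulr.
Qed.

Lemma dvN k x : dv k (- x) = dv k x.
Proof. by rewrite /dv /qnorm /= !sqrrN. Qed.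

Lemma dvB k x y : dv k x -> dv k y -> dv k (x - y).
Proof. by move=> hx hy; apply: dvD; rewrite ?dvN. Qed.

Lemma dv1_parity x : dv 1 x = (2 %| qre x + qi x + qj x + qk x)%Z.
Proof.
have sq (a : int) : exists t : int, a ^+ 2 = a + 2 * t.
  have [[q [_ [-> _]]]|[t Dt]] := sqr_parity a; first by exists (2 * q ^+ 2 - q); ring.
  exists ((a ^+ 2 - a) %/ 2)%Z; have := divz_eq (a ^+ 2 - a) 2.
  nia.
rewrite /dv /qnorm.
have [a ->] := sq (qre x); have [b ->] := sq (qi x).
have [c ->] := sq (qj x); have [d ->] := sq (qk x).
by clear; move: (qre x) (qi x) (qj x) (qk x) => ? ? ? ?; lia.
Qed.

(** By [dv1_parity], [dv 1] is the kernel of an additive map to the field with two elements, so the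
    quaternions of odd norm form a single coset of it. *)
Lemma dv1_odd x y : ~~ dv 1 x -> ~~ dv 1 y -> dv 1 (x - y).
Proof. by rewrite !dv1_parity /=; lia. Qed.

(** * Reduction of integer quaternions modulo [n] *)

Definition lip_intr (R : comNzRingType) x : lipschitz R :=
  Lipschitz (qre x)%:~R (qi x)%:~R (qj x)%:~R (qk x)%:~R.

Lemma lip_intrD (R : comNzRingType) x y :
  lip_intr R (x + y) = lip_intr R x + lip_intr R y.
Proof. by rewrite /lip_intr /= !intrD. Qed.

Lemma lip_intrB (R : comNzRingType) x y :
  lip_intr R (x - y) = lip_intr R x - lip_intr R y.
Proof. by rewrite /lip_intr /= !intrB. Qed.

Lemma lip_intrM (R : comNzRingType) x y :
  lip_intr R (x * y) = lip_intr R x * lip_intr R y.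
Proof.
case: x y => [a b c d] [a' b' c' d'].
by rewrite /lip_intr /= /lip_mul /= !(intrD, intrM, mulrNz).
Qed.

Section Reduction.
Variables (n : nat) (n_gt1 : (1 < n)%N).
Notation R := (lipschitz 'Z_n).
Notation red := (lip_intr 'Z_n).
Implicit Types a b : R.

Definition lip_lift a : lipschitz int :=
  Lipschitz (val (qre a) : nat)%:Z (val (qi a) : nat)%:Z
            (val (qj a) : nat)%:Z (val (qk a) : nat)%:Z.

Lemma lip_liftK a : red (lip_lift a) = a.
Proof. by case: a => x y z t; rewrite /lip_intr /= -!pmulrn !natr_Zp. Qed.

Lemma intr_Zp_eq0 (m : int) : (m%:~R == 0 :> 'Z_n) = (n %| m)%Z.
Proof.
have natP k : (k%:R == 0 :> 'Z_n) = (n %| k)%N.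
  by rewrite -val_eqE /= val_Zp_nat.
by case: m => k; rewrite ?NegzE ?mulrNz ?oppr_eq0 natP.
Qed.

Lemma lip_intr_eq0P x : reflect (exists y, x = y *+ n) (red x == 0).
Proof.
apply: (iffP eqP) => [[/eqP + /eqP + /eqP + /eqP] | [y ->]].
  rewrite !intr_Zp_eq0 => /dvdzP[a Da] /dvdzP[b Db] /dvdzP[c Dc] /dvdzP[d Dd].
  exists (Lipschitz a b c d); case: x Da Db Dc Dd => /= _ _ _ _ -> -> -> ->.
  by rewrite lip_mulrn; congr Lipschitz; rewrite -mulr_natr natz.
by rewrite lip_mulrn; congr Lipschitz; apply/eqP;
  rewrite /= intr_Zp_eq0 -mulr_natr natz dvdz_mull.
Qed.

End Reduction.

(** * Cancellation for the valuation and the pairing at the threshold [2 s] *)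

Lemma dv_norm_neq0 k x : ~~ dv k x -> qnorm x != 0.
Proof. by rewrite /dv; apply: contraNneq => ->; rewrite dvdz0. Qed.

Lemma dvE k x : qnorm x != 0 -> dv k x = (k <= logn 2 `|qnorm x|)%N.
Proof. by move=> nz; rewrite /dv dvdzE absz_nat pfactor_dvdn // absz_gt0. Qed.

(** The norm is multiplicative, so [v] is additive on products in either order, and [x] contributes
    at most [k] to the sum. *)
Lemma dv_cancel k l x y :
  ~~ dv k.+1 x -> dv (k + l) (x * y) || dv (k + l) (y * x) -> dv l y.
Proof.
move=> xk; have nx := dv_norm_neq0 xk; move: xk; rewrite dvE // -leqNgt => xk.
have [ny|ny] := eqVneq (qnorm y) 0; first by rewrite /dv ny dvdz0.
rewrite !dvE ?qnormM ?mulf_neq0 // !abszM !lognM ?absz_gt0 //.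
by case/orP; lia.
Qed.

(* Both products are odd multiples of [2 ^ s], so their difference vanishes to
   one order more. *)
Lemma dv_pairing s k l x y z u v :
    ~~ dv k.+1 x -> ~~ dv l.+1 y -> ~~ dv l.+1 z -> (k + l = s.*2)%N ->
    (x * y = u *+ 2 ^ s /\ x * z = v *+ 2 ^ s) \/
    (y * x = u *+ 2 ^ s /\ z * x = v *+ 2 ^ s) ->
  dv l.+1 (y - z).
Proof.
move=> hx hy hz kl h.
have odd t w : ~~ dv l.+1 t -> x * t = w *+ 2 ^ s \/ t * x = w *+ 2 ^ s -> ~~ dv 1 w.
  move=> ht tw; apply: contraNN ht => /(dv_mulrn s); rewrite addn1 => hw.
  by apply: (dv_cancel hx); rewrite addnS kl; case: tw => ->; rewrite hw ?orbT.
have uv : dv (s.*2 + 1) ((u - v) *+ 2 ^ s).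
  by apply/dv_mulrn/dv1_odd; [apply: odd hy _ | apply: odd hz _];
     case: h => -[h1 h2]; auto.
apply: (dv_cancel hx); rewrite addnS kl -addn1 mulrBr mulrBl.
by case: h => -[-> ->]; rewrite -mulrnBl uv ?orbT.
Qed.

(* The partner is [2 ^ (s - k) * qconj x]; for [s < k] the exponent is negative,
   but [2 ^ (k - s)] then divides [x]. *)
Lemma dv_partner s k x :
    dv k x -> ~~ dv k.+1 x -> (0 < k < s.*2)%N ->
  exists y u, [/\ dv (s.*2 - k) y, ~~ dv (s.*2 - k).+1 y & x * y = u *+ 2 ^ s].
Proof.
move=> hk hk1 /andP[k0 ks].
have nx := dv_norm_neq0 hk1.
have Vk : logn 2 `|qnorm x| = k.
  by apply/eqP; rewrite eqn_leq -dvE // hk andbT -ltnS ltnNge -dvE.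
have [u Du] : exists u : int, qnorm x = u * (2 ^ k)%N.
  by move: hk => /dvdzP[u Du]; exists u.
have mulE (a : int) m : a *+ m = a * m%:Z by rewrite -mulr_natr natz.
have [kles | klts] := leqP k s.
  exists (qconj x *+ 2 ^ (s - k)), (Lipschitz u 0 0 0).
  have ny : qnorm (qconj x *+ 2 ^ (s - k)) != 0.
    by rewrite qnormMn qnorm_conj mulf_neq0 // expf_neq0 // eqz_nat -lt0n expn_gt0.
  rewrite !dvE // qnormMn qnorm_conj abszM abszX lognM ?expn_gt0 ?absz_gt0 //.
  rewrite absz_nat lognX pfactorK // Vk.
  split; try (clear -kles; lia).
  rewrite mulrnAr mul_qconj Du !lip_mulrn /= !mul0rn -[in RHS](subnKC kles).
  by rewrite !mulE expnD PoszM mulrA.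
have [|y Dy] := @dv_div (k - s) x; first by apply: dv_leq hk; lia.
have ny : qnorm (qconj y) != 0.
  by apply: contraNneq nx; rewrite qnorm_conj Dy qnormMn => ->; rewrite mulr0.
have Vy : logn 2 `|qnorm (qconj y)| = (s.*2 - k)%N.
  move: Vk; rewrite Dy qnormMn abszM abszX lognM ?expn_gt0 //; last first.
    by rewrite absz_gt0 -qnorm_conj.
  by rewrite absz_nat lognX pfactorK // qnorm_conj; lia.
have [v Dv] : exists v : int, qnorm y = v * (2 ^ (s.*2 - k))%N.
  have : dv (s.*2 - k) (qconj y) by rewrite dvE // Vy.
  by rewrite dv_conj => /dvdzP[v Dv]; exists v.
exists (qconj y), (Lipschitz v 0 0 0); rewrite !dvE // Vy ltnn; split=> //.
rewrite Dy mulrnAl mul_qconj Dv !lip_mulrn /= !mul0rn.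
rewrite !mulE -mulrA -PoszM -expnD.
by congr Lipschitz; congr (_ * Posz (_ ^ _)); lia.
Qed.

(** * Levels of quaternions modulo [2 ^ s] *)

Section Level.
Variables (s : nat) (hs : (1 <= s)%N).
Notation R := (lipschitz 'Z_(2 ^ s)).
Notation red := (lip_intr 'Z_(2 ^ s)).
Implicit Types a b c : R.

Definition dvR k a := dv k (lip_lift a).
(** The lift of [0] has norm [0], where [logn] returns 0; the level is therefore meaningful only for
    [a != 0]. *)
Definition lev a := logn 2 `|qnorm (lip_lift a)|.

Let n_gt1 : (1 < 2 ^ s)%N.
Proof. by rewrite -{1}(expn0 2) ltn_exp2l. Qed.

(** Two lifts of a residue differ by a multiple of [2 ^ s], of valuation at least [2 s], so up to
    that bound the choice of lift is irrelevant. *)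
Lemma dvR_intr k x : (k <= s.*2)%N -> dvR k (red x) = dv k x.
Proof.
move=> ks; have /(lip_intr_eq0P n_gt1)[w Dw] : red (x - lip_lift (red x)) == 0.
  by rewrite lip_intrB lip_liftK subrr.
have hw : dv k (w *+ 2 ^ s).
  by apply: dv_leq (dv_mulrn s (_ : dv 0 w)); rewrite ?addn0 // /dv dvd1z.
rewrite /dvR; apply/idP/idP => h.
  by rewrite -[x](subrK (lip_lift (red x))) Dw dvD.
by rewrite -[lip_lift _](subKr x) Dw dvB.
Qed.

Lemma dv_intr_eq0 x : dv s.*2.+1 x -> red x = 0.
Proof. by case/dv_div => y Dx; apply/eqP/(lip_intr_eq0P n_gt1); exists y. Qed.

Lemma dvRE k a : a != 0 -> dvR k a = (k <= lev a)%N.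
Proof.
move=> nz; apply/dvE/(@dv_norm_neq0 s.*2.+1).
by apply: contraNN nz => /dv_intr_eq0; rewrite lip_liftK => ->.
Qed.

Lemma lev_max a : a != 0 -> (lev a <= s.*2)%N.
Proof.
move=> nz; rewrite leqNgt -dvRE //.
by apply: contraNN nz => /dv_intr_eq0; rewrite lip_liftK => ->.
Qed.

Lemma dvRzero k : dvR k (0 : R).
Proof. by rewrite /dvR; apply: dv0. Qed.

Lemma dvRD k a b : (k <= s.*2)%N -> dvR k a -> dvR k b -> dvR k (a + b).
Proof.
move=> ks ha hb; rewrite -[a]lip_liftK -[b]lip_liftK -lip_intrD dvR_intr //.
exact: dvD.
Qed.

Lemma dvRB k a b : (k <= s.*2)%N -> dvR k a -> dvR k b -> dvR k (a - b).
Proof.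
move=> ks ha hb; rewrite -[a]lip_liftK -[b]lip_liftK -lip_intrB dvR_intr //.
exact: dvB.
Qed.

Lemma lev_eqP k a : (lev a == k) && (a != 0) = dvR k a && ~~ dvR k.+1 a.
Proof.
have [->|nz] := eqVneq a 0; first by rewrite andbF !dvRzero.
by rewrite andbT !dvRE // -ltnNge ltnS eqn_leq andbC.
Qed.

Lemma mulR_dv_eq0 k l a b :
  dvR k a -> dvR l b -> (s.*2 < k + l)%N -> a * b = 0.
Proof.
move=> ha hb kl; rewrite -[a]lip_liftK -[b]lip_liftK -lip_intrM.
by apply/dv_intr_eq0/(dv_leq kl)/dvM.
Qed.

Lemma mulR_eq0_lev a b : a != 0 -> b != 0 -> a * b = 0 -> (s.*2 <= lev a + lev b)%N.
Proof.
move=> na nb ab0.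
have : dv s.*2 (lip_lift a * lip_lift b).
  by rewrite -dvR_intr // lip_intrM !lip_liftK ab0 dvRzero.
have := dvRE (lev a).+1 na; rewrite ltnn => /negbT ha h.
have : dvR (s.*2 - lev a) b.
  by apply: (dv_cancel ha); rewrite subnKC ?lev_max // h.
by rewrite dvRE //; lia.
Qed.

End Level.

Lemma lip_scalarl (c : int) x :
  Lipschitz c 0 0 0 * x = Lipschitz (c * qre x) (c * qi x) (c * qj x) (c * qk x).
Proof. by case: x => a b d e; congr Lipschitz => /=; ring. Qed.

Lemma lip_scalarC (c : int) x : x * Lipschitz c 0 0 0 = Lipschitz c 0 0 0 * x.
Proof. by case: x => a b d e; congr Lipschitz => /=; ring. Qed.

(** A uniformizer for [v]: its norm is 2, so multiplication by it raises valuations by exactly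
    one. *)
Definition qpi : lipschitz int := Lipschitz 1 1 0 0.

Lemma qnorm_pi k x : qnorm (qpi ^+ k * x) = (2 ^ k)%N%:Z * qnorm x.
Proof.
elim: k => [|k IHk]; first by rewrite !mul1r.
by rewrite exprS -mulrA qnormM IHk expnS PoszM mulrA.
Qed.

Lemma dv_pi k l x : dv (k + l) (qpi ^+ k * x) = dv l x.
Proof. by rewrite /dv qnorm_pi expnD PoszM dvdz_mul2l // eqz_nat -lt0n expn_gt0. Qed.

(** * Zero divisors, annihilators and twin classes in terms of levels *)

Section Vertices.
Variables (s : nat) (hs : (1 <= s)%N).
Notation R := (lipschitz 'Z_(2 ^ s)).
Notation red := (lip_intr 'Z_(2 ^ s)).
Implicit Types a b c : R.

Let n_gt1 : (1 < 2 ^ s)%N.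
Proof. by rewrite -{1}(expn0 2) ltn_exp2l. Qed.

Lemma lev_dv a : a != 0 -> ~~ dv (lev a).+1 (lip_lift a).
Proof. by move=> na; rewrite [X in ~~ X](dvRE hs) // ltnn. Qed.

(** Uniqueness at the threshold: on either side, [a] annihilates at most one coset of the
    complementary level. Existence is [partner]. *)
Lemma pairing_inj a b c :
    a != 0 -> b != 0 -> c != 0 ->
    (lev a + lev b = s.*2)%N -> lev c = lev b -> (0 < lev a)%N ->
    (a * b = 0 /\ a * c = 0) \/ (b * a = 0 /\ c * a = 0) ->
  dvR (lev b).+1 (b - c).
Proof.
move=> na nb nc lb lc la0 h0.
have -> : b - c = red (lip_lift b - lip_lift c) by rewrite lip_intrB !lip_liftK.
rewrite dvR_intr; [|by []|by lia].
have mul0 (p q : R) : p * q = 0 -> exists u, lip_lift p * lip_lift q = u *+ 2 ^ s.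
  move=> pq0; apply/(lip_intr_eq0P n_gt1).
  by rewrite lip_intrM !lip_liftK pq0 eqxx.
case: h0 => -[/mul0[u Du] /mul0[v Dv]];
  apply: (dv_pairing (lev_dv na) (lev_dv nb) _ lb (u := u) (v := v));
  by rewrite -?lc ?lev_dv //; auto.
Qed.

Lemma lev_intr k x : (k < s.*2)%N -> dv k x -> ~~ dv k.+1 x ->
  (lev (red x) == k) && (red x != 0).
Proof. by move=> ks h h1; rewrite (lev_eqP hs) !dvR_intr // ?h // ltnW. Qed.

Lemma partner a : a != 0 -> (0 < lev a < s.*2)%N ->
  exists b, [/\ b != 0, (lev a + lev b = s.*2)%N & a * b = 0].
Proof.
move=> na /[dup] ha /andP[la0 las].
have [|y [u [hy hy1 Du]]] := dv_partner _ (lev_dv na) ha.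
  by rewrite [dv _ _](dvRE hs).
have /andP[/eqP ly ny] : (lev (red y) == s.*2 - lev a)%N && (red y != 0).
  by apply: lev_intr => //; lia.
exists (red y); split; rewrite // ?ly; first by lia.
apply/eqP; rewrite -[a]lip_liftK -lip_intrM Du.
by apply/(lip_intr_eq0P n_gt1); exists u.
Qed.

(* The three classes are represented by [pi ^ (k - 1)] times [1 + i], [1 + j] and
   [1 + k], where [pi = 1 + i]. *)
Lemma level_reps k : (0 < k < s.*2)%N ->
  exists g : 'I_3 -> R, (forall i, lev (g i) = k /\ g i != 0) /\
    (forall i j, i != j -> ~~ dvR k.+1 (g i - g j)).
Proof.
move=> /andP[k0 ks].
pose e (i : 'I_3) : lipschitz int :=
  Lipschitz 1 (val i == 0)%N%:Z (val i == 1)%N%:Z (val i == 2)%N%:Z.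
have dvk l x : dv (k + l) (qpi ^+ k.-1 * x) = dv l.+1 x.
  by rewrite -[RHS](@dv_pi k.-1); congr dv; lia.
exists (fun i => red (qpi ^+ k.-1 * e i)); split=> [i|i j ij].
  have /andP[/eqP -> ->] // : (lev (red (qpi ^+ k.-1 * e i)) == k) &&
      (red (qpi ^+ k.-1 * e i) != 0).
  (* Each [e i] has norm 2, hence valuation 1, and the power of [qpi] adds [k - 1]. *)
  have := dvk 0%N (e i); have := dvk 1%N (e i); rewrite addn0 addn1 => h1 h0.
  apply: lev_intr; rewrite ?h0 ?h1 //.
    by case: i {h0 h1} => [[|[|[|i]]]].
  by case: i {h0 h1} => [[|[|[|i]]]].
(* The difference of two distinct [e i] again has norm 2, so after scaling its valuation is [k] and
   not [k + 1]. *)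
rewrite -lip_intrB dvR_intr // -mulrBr -addn1 dvk.
by case: i j ij => [[|[|[|i]]] ?] // [[|[|[|j]]] ?].
Qed.

(** Multiplying by the conjugate of [a] replaces [a] by its norm, an odd scalar, which is invertible
    modulo [2 ^ s] in each coordinate. *)
Lemma odd_norm_regular a b : ~~ dvR 1 a -> a * b = 0 \/ b * a = 0 -> b = 0.
Proof.
rewrite /dvR /dv expn1 => oddN ab0; set q := qnorm (lip_lift a) in oddN.
have copN : coprimez (2 ^ s)%N q.
  rewrite /coprimez /gcdz -[X in _ == X]/(Posz 1) eqz_nat absz_nat -/(coprime _ _).
  by rewrite coprimeXl // coprime2n; move: oddN; rewrite dvdzE dvdn2 negbK.
have /eqP : red (Lipschitz q 0 0 0 * lip_lift b) = 0.
  case: ab0 => ab0; first by rewrite -mul_qconjl !lip_intrM !lip_liftK -mulrA ab0 mulr0.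
  by rewrite -lip_scalarC -mul_qconj !lip_intrM !lip_liftK mulrA ab0 mul0r.
rewrite lip_scalarl => /eqP[] /eqP + /eqP + /eqP + /eqP.
rewrite !intr_Zp_eq0 // !Gauss_dvdzr // -!intr_Zp_eq0 //.
move=> /eqP h1 /eqP h2 /eqP h3 /eqP h4; rewrite -[b]lip_liftK.
by congr Lipschitz.
Qed.

Lemma nz_zero_divisorE a : (a \in @nz_zero_divisor R) = (a != 0) && (0 < lev a)%N.
Proof.
rewrite unfold_in; have [//|na /=] := eqVneq a 0.
apply/existsP/idP => [[b /andP[nb h]] | la].
  have -> : (0 < lev a)%N = dvR 1 a by rewrite (dvRE hs).
  apply: contraNT nb => odda; apply/eqP.
  by apply: (odd_norm_regular odda); case/orP: h => /eqP; auto.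
have := lev_max hs na; rewrite leq_eqVlt => /orP[/eqP la2|las].
  (* At the top level [a] annihilates itself, its levels being bounded below by [2 s] in one factor
     and 1 in the other. *)
  exists a; rewrite na (@mulR_dv_eq0 _ hs s.*2 1) ?eqxx ?dvRE ?la2 //; lia.
have [|b [nb _ ab0]] := partner na; first by rewrite la.
by exists b; rewrite nb ab0 eqxx.
Qed.

Lemma lev_translate a d : a != 0 -> (lev a < s.*2)%N -> dvR (lev a).+1 d ->
  lev (a + d) = lev a /\ a + d != 0.
Proof.
move=> na las hd.
have /andP[/eqP] // : (lev (a + d) == lev a) && (a + d != 0).
have /andP[h h1] : dvR (lev a) a && ~~ dvR (lev a).+1 a.
  by rewrite -(lev_eqP hs) eqxx.
rewrite (lev_eqP hs) dvRD //; last 2 first.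
- exact: ltnW.
- by rewrite /dvR; apply: dv_leq hd.
by apply: contraNN h1 => h2; have := dvRB hs las h2 hd; rewrite addrK.
Qed.

Notation V := (zdg_vertex (lipschitz 'Z_(2 ^ s))).
Implicit Types p q r : V.

Definition vlev p := lev (val p).

Lemma val_neq0 p : val p != 0.
Proof. by have := valP p; rewrite nz_zero_divisorE => /andP[]. Qed.

Lemma vlev_gt0 p : (0 < vlev p)%N.
Proof. by have := valP p; rewrite nz_zero_divisorE => /andP[]. Qed.

Lemma vlev_max p : (vlev p <= s.*2)%N.
Proof. by rewrite lev_max ?val_neq0. Qed.

Lemma vertex_of a : a != 0 -> (0 < lev a)%N -> exists p : V, val p = a.
Proof.
move=> na la; have Va : a \in @nz_zero_divisor R by rewrite nz_zero_divisorE na.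
by exists (Sub a Va); rewrite SubK.
Qed.

Lemma mul_vertex_eq0 p q : (vlev p + vlev q != s.*2)%N ->
  (val p * val q == 0) = (s.*2 < vlev p + vlev q)%N.
Proof.
move=> pq; apply/eqP/idP => [h | h].
  by rewrite ltn_neqAle eq_sym pq (mulR_eq0_lev hs) ?val_neq0.
by apply: (mulR_dv_eq0 hs _ _ h); rewrite (dvRE hs) ?val_neq0.
Qed.

Lemma vertex_partner p : (vlev p < s.*2)%N ->
  exists q, (vlev p + vlev q = s.*2)%N /\ val p * val q = 0.
Proof.
move=> ps; have [|b [nb lb pb]] := partner (val_neq0 p).
  by rewrite [X in (X && _)%N]vlev_gt0.
have [|q Dq] := vertex_of nb; first by move: ps lb; rewrite /vlev; lia.
by exists q; rewrite /vlev Dq.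
Qed.

Lemma pairing_vertex p q r :
    (vlev p + vlev q = s.*2)%N -> vlev r = vlev q ->
    (val p * val q = 0 /\ val p * val r = 0) \/
    (val q * val p = 0 /\ val r * val p = 0) ->
  dvR (vlev q).+1 (val q - val r).
Proof. by move=> pq rq h; apply: pairing_inj h; rewrite ?val_neq0 ?vlev_gt0. Qed.

(** Of the three cosets of [level_reps] at the complementary level, [p] annihilates at most one, so
    two remain. *)
Lemma nonpartners p : (vlev p < s.*2)%N ->
  exists q r, [/\ ~~ dvR (vlev q).+1 (val q - val r),
    (vlev p + vlev q = s.*2)%N, (vlev p + vlev r = s.*2)%N,
    val p * val q != 0 & val p * val r != 0].
Proof.
move=> ps; have p0 := vlev_gt0 p.
have [|g [lg dg]] := @level_reps (s.*2 - vlev p); first by lia.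
have gV i : exists q, val q = g i.
  by have [lgi ng] := lg i; apply: vertex_of => //; rewrite lgi subn_gt0.
have [v0 D0] := gV ord0; have [v1 D1] := gV (inord 1); have [v2 D2] := gV (inord 2).
have lv (v : V) i : val v = g i -> (vlev p + vlev v = s.*2)%N.
  by rewrite /vlev => ->; have [-> _] := lg i; rewrite subnKC ?vlev_max.
have dv (v w : V) (i j : 'I_3) : val v = g i -> val w = g j -> i != j ->
    ~~ dvR (vlev v).+1 (val v - val w).
  by move=> Dv Dw ij; rewrite /vlev Dv Dw; have [-> _] := lg i; apply: dg.
have kill (v w : V) (i j : 'I_3) : val v = g i -> val w = g j -> i != j ->
    val p * val v = 0 -> val p * val w != 0.
  move=> Dv Dw ij pv; apply: contra_notN (negP (dv v w i j Dv Dw ij)) => /eqP pw.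
  have lvE := lv _ _ Dv; have lwE := lv _ _ Dw.
  by apply: (pairing_vertex lvE); [lia | left].
have n01 : ord0 != inord 1 :> 'I_3 by rewrite -val_eqE /= inordK.
have n02 : ord0 != inord 2 :> 'I_3 by rewrite -val_eqE /= inordK.
have n12 : inord 1 != inord 2 :> 'I_3 by rewrite -val_eqE /= !inordK.
have [p0v|np0] := eqVneq (val p * val v0) 0.
  exists v1, v2; split; [exact: dv D1 D2 n12 | exact: lv D1 | exact: lv D2
    | exact: kill D0 D1 n01 p0v | exact: kill D0 D2 n02 p0v].
have [p1v|np1] := eqVneq (val p * val v1) 0.
  exists v0, v2; split; [exact: dv D0 D2 n02 | exact: lv D0 | exact: lv D2
    | by [] | exact: kill D1 D2 n12 p1v].
exists v0, v1; split; [exact: dv D0 D1 n01 | exact: lv D0 | exact: lv D1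
  | by [] | by []].
Qed.

Lemma in_nbhr p q : (q \in nbhr p) = (val p * val q == 0).
Proof. by rewrite in_set. Qed.

Lemma in_nbhl p q : (q \in nbhl p) = (val q * val p == 0).
Proof. by rewrite in_set. Qed.

(** A nonpartner of the vertex of lower level lies beyond the threshold for the higher one, so only
    the higher one annihilates it. *)
Lemma twin_vlev p q : twin p q -> vlev p = vlev q.
Proof.
have le (t t' : V) : twin t t' -> (vlev t' <= vlev t)%N.
  rewrite leqNgt => /andP[/eqP tt' _]; apply/negP => lt.
  have [|r [_ [_ tr _ nz _]]] := @nonpartners t.
    by apply: leq_trans lt (vlev_max t').
  have /setP/(_ r) := tt'; rewrite [LHS]in_nbhr [RHS]in_nbhr (negPf nz).
  rewrite mul_vertex_eq0; last by lia.
  by move=> /esym; lia.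
move=> pq; apply/eqP; rewrite eqn_leq; apply/andP; split; apply: le; last exact: pq.
by case/andP: pq => /eqP h1 /eqP h2; rewrite /twin eq_sym h1 eqxx eq_sym h2 eqxx.
Qed.

(** Twins share a partner, and the pairing at the threshold puts them in one coset. Conversely, a
    translation by something of higher valuation preserves the level, and its product with any
    vertex at the threshold vanishes. *)
Lemma twinP p q : (vlev p < s.*2)%N ->
  twin p q = dvR (vlev p).+1 (val q - val p).
Proof.
move=> ps; apply/idP/idP => [pq | d].
  have lpq := twin_vlev pq; case/andP: pq => /eqP/setP h _.
  have [r [pr pr0]] := vertex_partner ps.
  rewrite lpq; apply: (@pairing_vertex r) => //; first by lia.
  right; split => //; apply/eqP.
  by have := h r; rewrite [LHS]in_nbhr [RHS]in_nbhr pr0 eqxx.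
have [lq _] := lev_translate (val_neq0 p) ps d.
rewrite addrC subrK in lq.
have prod r : ((val p * val r == 0) = (val q * val r == 0)) /\
    ((val r * val p == 0) = (val r * val q == 0)).
  have [prs|prs] := eqVneq (vlev p + vlev r)%N s.*2; last first.
    by rewrite !mul_vertex_eq0 /vlev ?lq // 1?[X in X != _]addnC.
  have dr : dvR (vlev r) (val r) by rewrite (dvRE hs) ?val_neq0.
  rewrite -[val q](subrK (val p)) mulrDl mulrDr.
  by rewrite (mulR_dv_eq0 hs d dr) ?(mulR_dv_eq0 hs dr d) ?add0r //; lia.
rewrite /twin; apply/andP; split; apply/eqP/setP=> r; have [h1 h2] := prod r.
  rewrite [LHS]in_nbhr [RHS]in_nbhr; exact: h1.
rewrite [LHS]in_nbhl [RHS]in_nbhl; exact: h2.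
Qed.

Lemma partner_twin p q r : (vlev p + vlev q = s.*2)%N ->
    (vlev p + vlev r = s.*2)%N -> val p * val q = 0 ->
  (val p * val r == 0) = twin q r.
Proof.
move=> pq pr pq0; apply/eqP/idP => [pr0 | /andP[_ /eqP/setP/(_ p)]].
  have p0 := vlev_gt0 p; rewrite twinP; last by lia.
  have <- : vlev r = vlev q by lia.
  by apply: (pairing_vertex pr); [lia | left].
by rewrite [LHS]in_nbhl [RHS]in_nbhl pq0 eqxx => /esym/eqP.
Qed.

Lemma card_twin_class p : (vlev p < s.*2)%N ->
  #|twin_class p| = #|[set d : R | dvR (vlev p).+1 d]|.
Proof.
move=> ps; rewrite -(card_imset _ val_inj) -[RHS](card_imset _ (addrI (val p))).
congr #|pred_of_set _|; apply/setP=> a; apply/imsetP/imsetP => -[].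
  move=> q; rewrite inE twinP // => d ->; exists (val q - val p); rewrite ?inE //.
  by rewrite addrC subrK.
move=> d; rewrite inE => hd ->.
have [ld nd] := lev_translate (val_neq0 p) ps hd.
have [|q Dq] := vertex_of nd; first by rewrite ld [X in is_true X]vlev_gt0.
by exists q; rewrite // inE twinP // Dq addrC addKr.
Qed.

Lemma card_twin_class_vlev p q : vlev p = vlev q -> #|twin_class p| = #|twin_class q|.
Proof.
move=> pq; have := vlev_max p; rewrite leq_eqVlt => /orP[/eqP ps|ps]; last first.
  have qs : (vlev q < s.*2)%N by rewrite -pq; exact: ps.
  apply: etrans (card_twin_class ps) _.
  apply: etrans (esym (card_twin_class qs)).
  by rewrite pq.
(* A vertex of level [2 s] annihilates every vertex, levels being positive, so these vertices form
   one class. *)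
suff tw r : vlev r = s.*2 -> twin_class r = [set q' | vlev q' == s.*2].
  have qs : vlev q = s.*2 by rewrite -pq; exact: ps.
  by rewrite (tw p ps) (tw q qs).
move=> rs; apply/setP=> q'; rewrite !inE.
apply/idP/eqP => [/twin_vlev <- | q's]; first exact: rs.
have all (t t' : V) : vlev t = s.*2 -> (val t * val t' == 0) && (val t' * val t == 0).
  move=> ts; have t'0 := vlev_gt0 t'.
  by apply/andP; split; rewrite mul_vertex_eq0; lia.
rewrite /twin; apply/andP; split; apply/eqP/setP=> t.
  rewrite [LHS]in_nbhr [RHS]in_nbhr.
  by have /andP[-> _] := all r t rs; have /andP[-> _] := all q' t q's.
rewrite [LHS]in_nbhl [RHS]in_nbhl.
by have /andP[_ ->] := all r t rs; have /andP[_ ->] := all q' t q's.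
Qed.

End Vertices.

End LipschitzQuaternions.

Local Close Scope ring_scope.
Local Open Scope group_scope.

(** * Degrees determine levels and loops, in an abstract setting that covers both Gamma and
    Gamma_E *)

Section DegreeLevel.
Variables (X : finType) (P : rel X) (lv : X -> nat) (n : nat).
Implicit Types x y z : X.

Hypothesis lv_gt0 : forall x, (0 < lv x)%N.
Hypothesis lv_max : forall x, (lv x <= n)%N.
Hypothesis P_lv : forall x y, (lv x + lv y != n)%N -> P x y = (n < lv x + lv y)%N.
Hypothesis P_card : forall x y, (lv x < n)%N -> lv x = lv y ->
  #|[set z | (lv x + lv z == n)%N && P x z]| = #|[set z | (lv y + lv z == n)%N && P y z]|.
Hypothesis P_non : forall x, (lv x < n)%N -> exists y z,
  [/\ y != z, (lv x + lv y = n)%N, (lv x + lv z = n)%N, ~~ P x y & ~~ P x z].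

Variable e : rel X.
Hypothesis eE : forall x y, e x y = (x != y) && P x y.
Let D x := #|[set y | P x y]|.

(** Beyond the threshold the count depends on levels only; at the threshold it is [P_card]. *)
Lemma card_P_lv_eq x y : lv x = lv y -> D x = D y.
Proof.
pose B z := [set t | (lv z + lv t == n)%N].
have DE z : D z = (#|[set t | (lv z + lv t == n)%N && P z t]| +
    #|[set t | (n < lv z + lv t)%N]|)%N.
  rewrite /D -(cardsID (B z)); congr (_ + _)%N; apply: eq_card => t.
    by rewrite !inE andbC.
  by rewrite !inE; case: eqVneq => [->|/P_lv ->]; rewrite ?ltnn.
move=> xy; rewrite !DE; congr (_ + _)%N; last by rewrite xy.
have [xn|nx] := ltnP (lv x) n; first exact: P_card.
(* At level [n] nothing lies at the threshold, because levels are positive. *)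
by rewrite !eq_card0 // => z; rewrite !inE; have := lv_gt0 z; case: eqP => //; lia.
Qed.

(** Passing to the higher level keeps every element related to [x] and gains the two from [P_non],
    which then exceed the threshold. *)
Lemma card_P_lv_lt x y : (lv x < lv y)%N -> (D x + 2 <= D y)%N.
Proof.
move=> xy; have [|u [v [uv xu xv Pu Pv]]] := @P_non x.
  by apply: leq_trans xy (lv_max y).
have <- : #|[set t | P x t] :|: [set u; v]| = (D x + 2)%N.
  rewrite cardsU cards2 uv (_ : _ :&: _ = set0) ?cards0 ?subn0 //.
  apply/setP=> t; rewrite !inE; apply/andP=> -[Pt /orP[]/eqP tE].
    by rewrite tE (negPf Pu) in Pt.
  by rewrite tE (negPf Pv) in Pt.
apply/subset_leq_card/subsetP=> t; rewrite !inE => /orP[Pt|tuv].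
  rewrite P_lv; last first.
    have [xt|xt] := eqVneq (lv x + lv t)%N n; first by lia.
    by rewrite P_lv // in Pt; lia.
  have [xt|xt] := eqVneq (lv x + lv t)%N n; first by lia.
  by rewrite P_lv // in Pt; lia.
have xt : (lv x + lv t)%N = n by case/orP: tuv => /eqP ->.
by rewrite P_lv; lia.
Qed.

(* The degree of [x] is [D x - P x x].  A lower level costs at least two
   neighbours, more than the loop correction, so degrees separate levels; within
   a level [D] is constant, so degrees then detect loops. *)
Lemma graph_aut_lv (p : {perm X}) x : p \in graph_aut e ->
  lv (p x) = lv x /\ P (p x) (p x) = P x x.
Proof.
rewrite inE => /'forall_forallP pe.
have DE y : D y = (P y y + #|[set z | e y z]|)%N.
  rewrite /D (cardsD1 y) inE; congr (_ + _)%N.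
  by apply: eq_card => z; rewrite !inE eE eq_sym.
have deg : #|[set z | e (p x) z]| = #|[set z | e x z]|.
  rewrite -(card_imset [set z | e x z] (@perm_inj _ p)); apply: eq_card => z.
  rewrite !inE -[z in LHS](permKV p) (eqP (pe _ _)).
  by rewrite -[z in RHS](permKV p) mem_imset ?inE //; apply: perm_inj.
have lvE : lv (p x) = lv x.
  have := DE x; have := DE (p x); rewrite deg.
  have [h|h|//] := ltngtP (lv (p x)) (lv x);
    by have := card_P_lv_lt h; case: (P x x) (P (p x) (p x)) => -[] /=; lia.
split=> //; have := card_P_lv_eq lvE; rewrite !DE deg => /addIn.
by case: (P x x) (P (p x) (p x)) => -[].
Qed.

End DegreeLevel.

(** * Lifting automorphisms of Gamma_E and splitting off the regular ones *)

Section Lift.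
Variable R : finNzRingType.
Notation V := (zdg_vertex R).
Notation E := (cg_vertex R).
Implicit Types (a b c : V) (A B : E) (u v : {perm E}).
Notation autE := (graph_aut_group (@cg_edge R)).
Notation cls := (@cg_class R).

Lemma twin_sym a b : twin a b = twin b a.
Proof. by rewrite /twin; congr (_ && _); apply: eq_sym. Qed.

Lemma cg_class_eq a b : (cls a == cls b) = twin a b.
Proof.
rewrite -val_eqE /=; apply/eqP/idP => [/setP/(_ b)|ab].
  by rewrite !inE => ->; rewrite /twin !eqxx.
apply/setP=> c; rewrite !inE; move: ab; rewrite /twin.
by case/andP=> /eqP-> /eqP->.
Qed.

Lemma mem_cg_vertex a A : (a \in val A) = (cls a == A).
Proof.
have /imsetP[c _ Ac] := valP A; have -> : A = cls c by apply: val_inj.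
by rewrite cg_class_eq /= inE twin_sym.
Qed.

Lemma cg_vertex_rep A : exists a, cls a == A.
Proof.
by have /imsetP[c _ Ac] := valP A; exists c; apply/eqP/val_inj.
Qed.

Definition class_rep A : V := xchoose (cg_vertex_rep A).

Lemma class_repK A : cls (class_rep A) = A.
Proof. exact/eqP/(xchooseP (cg_vertex_rep A)). Qed.

Lemma cg_vertexP A : exists a, cls a = A.
Proof. by exists (class_rep A); rewrite class_repK. Qed.

Lemma twin_rep a : twin (class_rep (cls a)) a.
Proof. by rewrite -cg_class_eq class_repK. Qed.

Lemma mul_twin a b a' b' : twin a a' -> twin b b' ->
  ((val a * val b)%R == 0%R) = ((val a' * val b')%R == 0%R).
Proof.
case/andP=> /eqP/setP/(_ b) + _ /andP[_ /eqP/setP/(_ a')].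
by rewrite !inE => -> ->.
Qed.

Lemma cg_edge_rep A B : cg_edge A B =
  (A != B) && ((val (class_rep A) * val (class_rep B))%R == 0%R).
Proof.
rewrite -[A in LHS]class_repK -[B in LHS]class_repK cg_edgeE !class_repK.
have [//|AB] := eqVneq A B; rewrite /zdg_edge (_ : class_rep A != class_rep B) //.
by apply: contraNneq AB => h; rewrite -[A]class_repK h class_repK.
Qed.

Hypothesis card_val : forall u A, u \in autE -> #|val (u A)| = #|val A|.

(** Sends the element at a given position of a class to the one at the same position of the image
    class. The enumerations depend on the classes alone, which makes lifting multiplicative; on
    [autE] the default of [nth] is out of reach by [index_lt]. *)
Definition lift_vertex u a :=
  nth a (enum (val (u (cls a)))) (index a (enum (val (cls a)))).

Lemma index_lt u a : u \in autE ->
  (index a (enum (val (cls a))) < size (enum (val (u (cls a)))))%N.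
Proof.
move=> uE; rewrite -cardE card_val // cardE index_mem mem_enum.
by rewrite mem_cg_vertex.
Qed.

Lemma cg_class_lift u a : u \in autE -> cls (lift_vertex u a) = u (cls a).
Proof.
move=> uE; apply/eqP; rewrite -mem_cg_vertex -mem_enum mem_nth //.
exact: index_lt.
Qed.

Lemma lift_vertexM u v a : u \in autE -> v \in autE ->
  lift_vertex (u * v) a = lift_vertex v (lift_vertex u a).
Proof.
move=> uE vE; rewrite {2}/lift_vertex cg_class_lift // /lift_vertex permM.
rewrite index_uniq ?enum_uniq ?index_lt //.
by apply: set_nth_default; rewrite -permM index_lt ?groupM.
Qed.

Lemma lift_vertex1 a : lift_vertex 1 a = a.
Proof. by rewrite /lift_vertex perm1 nth_index // mem_enum mem_cg_vertex. Qed.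

Lemma lift_vertex_inj u : u \in autE -> injective (lift_vertex u).
Proof.
move=> uE; apply: (can_inj (g := lift_vertex u^-1)) => a.
by rewrite -lift_vertexM ?groupV // mulgV lift_vertex1.
Qed.

(** The value [1] is a default that [lift_vertex_inj] rules out on [autE]. *)
Definition lift_perm u : {perm V} :=
  if injectiveP (lift_vertex u) is ReflectT inj then perm inj else 1.

Lemma lift_permE u a : u \in autE -> lift_perm u a = lift_vertex u a.
Proof.
move=> uE; rewrite /lift_perm; case: injectiveP => [inj|[]]; first by rewrite permE.
exact: lift_vertex_inj.
Qed.

Lemma lift_permM : {in autE &, {morph lift_perm : u v / u * v}}.
Proof.
move=> u v uE vE; apply/permP=> a.
by rewrite permM !lift_permE ?groupM // lift_vertexM.
Qed.
Canonical lift_morphism := Morphism lift_permM.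

Lemma cg_class_lift_perm u a : u \in autE -> cls (lift_perm u a) = u (cls a).
Proof. by move=> uE; rewrite lift_permE // cg_class_lift. Qed.

Lemma injm_lift : 'injm lift_morphism.
Proof.
apply/subsetP=> u /morphpreP[uE /set1P u1]; rewrite inE; apply/eqP/permP=> A.
by have [a <-] := cg_vertexP A; rewrite -cg_class_lift_perm // u1 !perm1.
Qed.

Notation K := (regular_aut_group R).
Notation G := (graph_aut_group (@zdg_edge R)).
Local Open Scope ring_scope.

(** Adjacency ignores squares, so both graphs need separate control of which vertices square to
    zero; degrees provide it later. *)
Hypothesis loop_aut : forall (p : {perm V}) a, p \in G ->
  (val (p a) * val (p a) == 0) = (val a * val a == 0).
Hypothesis loop_lift : forall u a b, u \in autE -> cls b = u (cls a) ->
  (val b * val b == 0) = (val a * val a == 0).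

Lemma regular_cls (p : {perm V}) : (p \in K) = [forall a, cls (p a) == cls a].
Proof.
rewrite inE; apply: eq_forallb => a.
by rewrite cg_class_eq twin_sym.
Qed.

Lemma mul_aut (p : {perm V}) a b : p \in G ->
  (val (p a) * val (p b) == 0) = (val a * val b == 0).
Proof.
move=> pG; have [->|ab] := eqVneq a b; first exact: loop_aut.
move: pG; rewrite inE => /'forall_forallP/(_ a b)/eqP.
by rewrite /zdg_edge (inj_eq perm_inj) ab.
Qed.

Lemma twin_aut (p : {perm V}) a b : p \in G -> twin (p a) (p b) = twin a b.
Proof.
move=> pG; rewrite /twin; congr (_ && _); apply/eqP/eqP => /setP h; apply/setP=> c.
- by have := h (p c); rewrite !inE !mul_aut.
- by rewrite -[c](permKV p) !inE !mul_aut //; have := h (p^-1 c)%g; rewrite !inE.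
- by have := h (p c); rewrite !inE !mul_aut.
- by rewrite -[c](permKV p) !inE !mul_aut //; have := h (p^-1 c)%g; rewrite !inE.
Qed.

(** Between distinct classes adjacency is that of Gamma_E. Inside one class a product vanishes
    exactly when the squares do, which is the case for [loop_lift]. *)
Lemma lift_in_aut u : u \in autE -> lift_perm u \in G.
Proof.
move=> uE; rewrite inE; apply/'forall_forallP=> a b; apply/eqP.
have [ab|ab] := eqVneq (cls a) (cls b); last first.
  have uab : u (cls a) != u (cls b) by rewrite (inj_eq perm_inj).
  have := uE; rewrite inE => /'forall_forallP/(_ (cls a) (cls b))/eqP.
  rewrite cg_edgeE ab -!cg_class_lift_perm // cg_edgeE /=.
  by rewrite !cg_class_lift_perm // uab.
rewrite /zdg_edge (inj_eq perm_inj); congr (_ && _).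
have t0 c : twin c c by rewrite /twin !eqxx.
have tab : twin b a by rewrite -cg_class_eq ab.
have tuab : twin (lift_perm u b) (lift_perm u a).
  by rewrite -cg_class_eq !cg_class_lift_perm // ab.
rewrite (mul_twin (t0 _) tab) (mul_twin (t0 _) tuab).
by apply: (loop_lift uE); rewrite cg_class_lift_perm.
Qed.

(** Classes are nonempty, so the default never occurs; for [p] in [G] the choice made by [pick] does
    not matter, by [twin_aut]. *)
Definition class_map (p : {perm V}) A : E :=
  if [pick a in val A] is Some a then cls (p a) else A.

Lemma class_mapE (p : {perm V}) a : p \in G -> class_map p (cls a) = cls (p a).
Proof.
move=> pG; rewrite /class_map; case: pickP => [b|/(_ a)]; last first.
  by rewrite mem_cg_vertex eqxx.
rewrite mem_cg_vertex => /eqP ba; apply/eqP.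
by rewrite cg_class_eq twin_aut // -cg_class_eq ba.
Qed.

Lemma aut_class (p : {perm V}) : p \in G ->
  exists2 u, u \in autE & forall a, u (cls a) = cls (p a).
Proof.
move=> pG; have inj : injective (class_map p).
  move=> A B; have [a <-] := cg_vertexP A; have [b <-] := cg_vertexP B.
  by rewrite !class_mapE // => /eqP; rewrite cg_class_eq twin_aut // -cg_class_eq => /eqP.
exists (perm inj) => [|a]; last by rewrite permE class_mapE.
rewrite inE; apply/'forall_forallP=> A B; rewrite !permE.
have [a <-] := cg_vertexP A; have [b <-] := cg_vertexP B.
rewrite !class_mapE // !cg_edgeE !cg_class_eq twin_aut //.
by have := pG; rewrite inE => /'forall_forallP/(_ a b)/eqP ->.
Qed.

Local Open Scope group_scope.

(** The regular automorphisms are those fixing every twin class, hence a normal subgroup; a lift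
    that fixes every class comes from the identity. *)
Lemma sdprod_aut : K ><| (lift_morphism @* autE) = G.
Proof.
have sHG : lift_morphism @* autE \subset G.
  by apply/subsetP=> p /morphimP[u _ uE ->]; apply: lift_in_aut.
have nKG : G \subset 'N(K).
  apply/subsetP=> p pG; rewrite inE; apply/subsetP=> _ /imsetP[q qK ->].
  move: qK; rewrite !regular_cls => /forallP qK; apply/forallP=> a.
  rewrite !permM cg_class_eq -[a in twin _ a](permKV p) twin_aut // -cg_class_eq.
  exact: qK.
rewrite sdprodE; first 1 last.
- exact: subset_trans sHG nKG.
- apply/trivgP/subsetP=> p /setIP[pK /morphimP[u _ uE Dp]].
  rewrite inE Dp -(morph1 lift_morphism); apply/eqP; congr lift_perm.
  apply/permP=> A; have [a <-] := cg_vertexP A; rewrite perm1.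
  move: pK; rewrite regular_cls Dp => /forallP/(_ a) /eqP.
  by rewrite /= cg_class_lift_perm.
apply/eqP; rewrite eqEsubset mul_subG ?regular_aut_sub //=.
(* Dividing [p] by the lift of the automorphism it induces on classes leaves a regular factor. *)
apply/subsetP=> p pG; have [u uE Du] := aut_class pG.
have uH : lift_perm u \in lift_morphism @* autE by apply: mem_morphim.
rewrite -[p](mulgKV (lift_perm u)) mem_mulg // regular_cls; apply/forallP=> a.
by rewrite permM; apply/eqP/(@perm_inj _ u); rewrite -cg_class_lift_perm // permKV Du.
Qed.
End Lift.

(** Passes from an internal to an external semidirect product: [D] acts on [K] by conjugation
    through [f]. *)
Lemma sdprod_isog_ext (gT aT : finGroupType) (G K : {group gT}) (D : {group aT})
    (f : {morphism D >-> gT}) : 'injm f -> K ><| (f @* D) = G ->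
  exists act : groupAction D K, G \isog [set: sdprod_by act].
Proof.
move=> injf defG; have /sdprodP[_ defKD nKD tiKD] := defG.
have actK : {acts f @* D, on group K | 'J} by split=> //; rewrite astabsJ.
pose act0 : groupAction _ K := (<[actK]> \o f)%gact.
(* The composite action lives on the preimage of [f @* D] and has to be restricted to [D]. *)
have sD : D \subset f @*^-1 (f @* D) by rewrite -sub_morphim_pre.
pose act := (act0 \ sD)%gact.
exists act.
have actf : {in K & D, morph_act act 'J (idm K) f}.
  move=> x d Kx Dd /=; rewrite /actby Kx mem_morphim //=.
rewrite isog_sym; apply/isogP; exists (xsdprod_morphism actf).
  rewrite injm_xsdprodm injm_idm injf /= im_idm tiKD eqxx //.
by rewrite im_xsdprodm im_idm.
Qed.

(** * Preservation of levels and loops in Gamma and Gamma_E, and the splitting *)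

Section Main.
Variables (s : nat) (hs : (1 <= s)%N).
Notation V := (zdg_vertex (lipschitz 'Z_(2 ^ s))).
Notation E := (cg_vertex (lipschitz 'Z_(2 ^ s))).
Notation cls := (@cg_class (lipschitz 'Z_(2 ^ s))).
Implicit Types (p q r : V) (A B : E).
Local Open Scope ring_scope.

(** Supplies the threshold count for [graph_aut_lv]: a class size in Gamma, one in Gamma_E. *)
Lemma partner_set p : (vlev p < s.*2)%N -> exists q,
  (vlev p + vlev q = s.*2)%N /\
  forall r, ((vlev p + vlev r == s.*2)%N && (val p * val r == 0)) = twin q r.
Proof.
move=> ps; have [q [pq pq0]] := vertex_partner hs ps.
exists q; split=> // r; have [pr|pr] := eqVneq (vlev p + vlev r)%N s.*2.
  exact: (partner_twin hs pq pr pq0).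
apply/esym/negP => /(twin_vlev hs) qr.
by rewrite -qr pq eqxx in pr.
Qed.

Lemma zdg_aut_loop (u : {perm V}) p :
    u \in graph_aut (@zdg_edge (lipschitz 'Z_(2 ^ s))) ->
  (val (u p) * val (u p) == 0) = (val p * val p == 0).
Proof.
move=> uG.
have [] := @graph_aut_lv V (fun p q => val p * val q == 0) (@vlev s) s.*2 _ _ _ _ _
  (@zdg_edge _) _ u p uG.
- exact: vlev_gt0.
- exact: vlev_max.
- exact: mul_vertex_eq0.
- move=> x y xs xy.
  have card (t : V) : (vlev t < s.*2)%N -> exists r, (vlev t + vlev r = s.*2)%N /\
     #|[set z : V | (vlev t + vlev z == s.*2)%N && (val t * val z == 0)]| =
     #|twin_class r|.
    move=> ts; have [r [tr h]] := partner_set ts; exists r; split=> //.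
    by apply: eq_card => z; rewrite [LHS]in_set [RHS]in_set h.
  have ys : (vlev y < s.*2)%N by rewrite -xy; exact: xs.
  have [qx [lx ->]] := card x xs; have [qy [ly ->]] := card y ys.
  by apply: card_twin_class_vlev => //; lia.
- move=> x xs; have [q [r [qr xq xr xq0 xr0]]] := nonpartners hs xs.
  exists q, r; split=> //; apply: contraNneq qr => ->; rewrite subrr.
  exact: dvRzero.
- by [].
- by move=> _ h; exact: h.
Qed.

Lemma cg_aut_lv (u : {perm E}) A : u \in graph_aut (@cg_edge (lipschitz 'Z_(2 ^ s))) ->
  vlev (class_rep (u A)) = vlev (class_rep A) /\
  (val (class_rep (u A)) * val (class_rep (u A)) == 0) =
  (val (class_rep A) * val (class_rep A) == 0).
Proof.
move=> uG.
have PE A' p : (val (class_rep A') * val (class_rep (cls p)) == 0) =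
    (val (class_rep A') * val p == 0).
  by apply: mul_twin (twin_rep p); rewrite -cg_class_eq.
have lvE p : vlev (class_rep (cls p)) = vlev p by apply: twin_vlev hs _ _ (twin_rep p).
apply: (@graph_aut_lv E (fun A B => val (class_rep A) * val (class_rep B) == 0)
  (fun A => vlev (class_rep A)) s.*2 _ _ _ _ _ (@cg_edge _) _ u A uG).
- by move=> x; exact: vlev_gt0.
- by move=> x; exact: vlev_max.
- by move=> x y; exact: mul_vertex_eq0.
- move=> x y xs xy.
  have card (t : E) : (vlev (class_rep t) < s.*2)%N ->
     #|[set z : E | (vlev (class_rep t) + vlev (class_rep z) == s.*2)%N &&
          (val (class_rep t) * val (class_rep z) == 0)]| = 1%N.
    move=> ts; have [r [tr h]] := partner_set ts.
    rewrite -[RHS](cards1 (cls r)); apply: eq_card => z.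
    rewrite [LHS]in_set [RHS]in_set1 h.
    by rewrite -cg_class_eq class_repK eq_sym.
  have ys : (vlev (class_rep y) < s.*2)%N by rewrite -xy; exact: xs.
  exact: etrans (card x xs) (esym (card y ys)).
- move=> x xs; have [q [r [qr xq xr xq0 xr0]]] := nonpartners hs xs.
  exists (cls q), (cls r).
  split; [| rewrite lvE; exact: xq | rewrite lvE; exact: xr
    | rewrite PE; exact: xq0 | rewrite PE; exact: xr0].
  (* Gamma_E needs two distinct classes, not just two vertices; [twinP] reads this off the
     separation of cosets. *)
  have rq : vlev r = vlev q by lia.
  have rs : (vlev r < s.*2)%N by have := vlev_gt0 hs (class_rep x); lia.
  by rewrite cg_class_eq twin_sym (twinP hs _ rs) rq.
- exact: cg_edge_rep.
Qed.

End Main.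

Theorem theorem3p10 (s : nat) (hs : (1 <= s)%N) :
  exists act : groupAction
      (graph_aut_group (@cg_edge (lipschitz 'Z_(2 ^ s))))
      (regular_aut_group (lipschitz 'Z_(2 ^ s))),
    graph_aut (@zdg_edge (lipschitz 'Z_(2 ^ s))) \isog
      [set: sdprod_by act].
Proof.
(* Automorphisms of Gamma_E preserve levels, and the size of a class depends on its level alone. *)
have card_val (u : {perm cg_vertex (lipschitz 'Z_(2 ^ s))}) A :
    u \in graph_aut (@cg_edge (lipschitz 'Z_(2 ^ s))) ->
    #|val (u A)| = #|val A|.
  move=> /(cg_aut_lv hs A)[lu _].
  rewrite -[A in RHS]class_repK -[u A in LHS]class_repK.
  exact: card_twin_class_vlev hs _ _ lu.
apply: (@sdprod_isog_ext _ _ (graph_aut_group (@zdg_edge (lipschitz 'Z_(2 ^ s)))) _ _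
  (lift_morphism card_val)).
  exact: injm_lift.
apply: sdprod_aut => [u p uG|u p q uG qE]; first exact: zdg_aut_loop.
have tq : twin (class_rep (u (cg_class p))) q by rewrite -cg_class_eq class_repK qE.
have [_ h] := @cg_aut_lv s hs u (cg_class p) uG.
by rewrite -(mul_twin tq tq) -(mul_twin (twin_rep p) (twin_rep p)).
Qed.
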